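(* Let $S_0$ be the initial state of the bit-flipping automaton language, so that $(\varnothing,S_0)\in\mathsf{NCfg}$. Then $$(\varnothing,S_0)\in\mathcal{E}[\![(1\oplus 1)\mathbin{\&}(1\oplus 1)]\!].$$
   Context: **Runtime.** $\mathbb{A}$ is a countably infinite set of channel names. A payload is one of $\pi_1$, $\pi_2$, the closing signal $()$, or a channel name. An action is either the silent action $\varepsilon$ or a triple (channel $a$, direction $!$ or $?$, payload $p$), written $a!p$ or $a?p$. For a set $X$, $\mathsf{Atomic}(X)$ consists of the elements $\mathsf{proc}[a](P)$ ($a\in\mathbb{A}$, $P\in X$) and $\mathsf{fwd}[a](b)$ ($a,b\in\mathbb{A}$). $\mathsf{FMSet}(X)$ is the set of finite multisets over $X$, with sum $\uplus$ and unit $\varnothing$. A process language $L$ consists of a set $L.\mathsf{NObj}$ (nameless objects) and a relation $(P,a)\xrightarrow{\alpha}_{L}\Omega'$ with $P\in L.\mathsf{NObj}$, $a\in\mathbb{A}$, $\alpha$ an action, $\Omega'\in\mathsf{FMSet}(\mathsf{Atomic}(L.\mathsf{NObj}))$. Fix a set $\mathsf{ProcLang}$ of process languages; here it is assumed to contain the bit-flipping automaton language defined below. Put $\mathsf{NObj}=\sum_{L\in\mathsf{ProcLang}}L.\mathsf{NObj}$ (objects of a language are regarded as elements of it by tagging with the language, and likewise for multisets of atomic processes), $\mathsf{Obj}=\mathsf{Atomic}(\mathsf{NObj})$, $\mathsf{Cfg}=\mathsf{FMSet}(\mathsf{Obj})$, $\mathsf{NCfg}=\mathsf{Cfg}\times\mathsf{NObj}$.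 For $N=(\Omega,P)\in\mathsf{NCfg}$ and $a\in\mathbb{A}$, $N[a]=\Omega\uplus\{\mathsf{proc}[a](P)\}$. The labelled transition relation on $\mathsf{Cfg}$ is inductively generated by: - (Obj) if $(P,a)\xrightarrow{\alpha}_{L}\Omega'$ then $\{\mathsf{proc}[a](P)\}\xrightarrow{\alpha}\Omega'$; - (Fwd) $\{\mathsf{proc}[a](P),\mathsf{fwd}[b](a)\}\xrightarrow{\varepsilon}\{\mathsf{proc}[b](P)\}$; - (Frame) if $\Omega\xrightarrow{\alpha}\Omega'$ then $\Omega\uplus\Omega_0\xrightarrow{\alpha}\Omega'\uplus\Omega_0$; - (Comm) if $\Omega_1\xrightarrow{a!c}\Omega_1'$ and $\Omega_2\xrightarrow{a?c}\Omega_2'$ then $\Omega_1\uplus\Omega_2\xrightarrow{\varepsilon}\Omega_1'\uplus\Omega_2'$. $\to^*$ is the reflexive-transitive closure of $\xrightarrow{\varepsilon}$. For $N,N'\in\mathsf{NCfg}$, $N\to^*_{\mathsf{NCfg}}N'$ iff $\forall a\in\mathbb{A}.\ N[a]\to^* N'[a]$. **Types and logical relation.** Types: $A,B::=1\mid A\otimes B\mid A\oplus B\mid A\mathbin{\&}B\mid A\multimap B$. The subsets $\mathcal{E}[\![A]\!],\mathcal{V}[\![A]\!]\subseteq\mathsf{NCfg}$ are defined by recursion on types (with $a,b$ ranging over $\mathbb{A}$): - $N\in\mathcal{E}[\![A]\!]$ iff $\exists N'.\ N\to^*_{\mathsf{NCfg}}N'$ and $N'\in\mathcal{V}[\![A]\!]$;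 - $N\in\mathcal{V}[\![1]\!]$ iff $\forall a.\ N[a]\xrightarrow{a!()}\varnothing$; - $N\in\mathcal{V}[\![A\otimes B]\!]$ iff $\exists a\,\forall b\,\exists N_1\in\mathcal{E}[\![A]\!]\,\exists N_2\in\mathcal{E}[\![B]\!].\ N[b]\xrightarrow{b!a}N_1[a]\uplus N_2[b]$; - $N\in\mathcal{V}[\![A\multimap B]\!]$ iff $\forall a\,\forall b\,\forall N_1\in\mathcal{E}[\![A]\!]\,\exists N_2\in\mathcal{E}[\![B]\!].\ N[b]\uplus N_1[a]\xrightarrow{b?a}N_2[b]$; - $N\in\mathcal{V}[\![A\mathbin{\&}B]\!]$ iff $(\forall a\,\exists N_1\in\mathcal{E}[\![A]\!].\ N[a]\xrightarrow{a?\pi_1}N_1[a])$ and $(\forall a\,\exists N_2\in\mathcal{E}[\![B]\!].\ N[a]\xrightarrow{a?\pi_2}N_2[a])$; - $N\in\mathcal{V}[\![A\oplus B]\!]$ iff $(\forall a\,\exists N_1\in\mathcal{E}[\![A]\!].\ N[a]\xrightarrow{a!\pi_1}N_1[a])$ or $(\forall a\,\exists N_2\in\mathcal{E}[\![B]\!].\ N[a]\xrightarrow{a!\pi_2}N_2[a])$. **Bit-flipping automaton language.** Its set of nameless objects is $\{S_0,S_1,S_2,S_3\}$ and its transitions are exactly, for all $a\in\mathbb{A}$: $(S_0,a)\xrightarrow{a?\pi_1}\{\mathsf{proc}[a](S_1)\}$; $(S_0,a)\xrightarrow{a?\pi_2}\{\mathsf{proc}[a](S_2)\}$; $(S_1,a)\xrightarrow{a!\pi_2}\{\mathsf{proc}[a](S_3)\}$;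 $(S_2,a)\xrightarrow{a!\pi_1}\{\mathsf{proc}[a](S_3)\}$; $(S_3,a)\xrightarrow{a!()}\varnothing$. *)

(* Defs.v *)
From HB Require Import structures.
From Stdlib Require Export Relation_Operators.
From mathcomp Require Export all_boot finmap multiset.
From mathcomp Require Export boolp classical_sets cardinality.

Set Implicit Arguments.
Unset Strict Implicit.
Unset Printing Implicit Defensive.

Local Open Scope classical_set_scope.
Local Open Scope mset_scope.

Inductive payload (A : Type) : Type :=
  | Pi1 | Pi2 | Close | Name of A.
Arguments Pi1 {A}.
Arguments Pi2 {A}.
Arguments Close {A}.

Inductive direction : Type := Send | Recv.

Inductive action (A : Type) : Type :=
  | Silent
  | Act of A & direction & payload A.
Arguments Silent {A}.

Notation "a '!!' p" := (Act a Send p) (at level 45, no associativity).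
Notation "a '??' p" := (Act a Recv p) (at level 45, no associativity).

Inductive atomic (A X : Type) : Type :=
  | Proc of A & X
  | Fwd of A & A.
Arguments Proc {A X}.
Arguments Fwd {A X}.

(* Finite multisets require a choiceType; this instance is classical, so that
   A and X may be arbitrary types. *)
HB.instance Definition _ (A X : Type) := gen_eqMixin (atomic A X).
HB.instance Definition _ (A X : Type) := gen_choiceMixin (atomic A X).

Definition atomic_map (A X Y : Type) (f : X -> Y) (o : atomic A X) :
    atomic A Y :=
  match o with
  | Proc a P => Proc a (f P)
  | Fwd a b => Fwd a b
  end.

(* Direct image of a finite multiset, multiplicities being added up. *)
Definition mset_map (K K' : choiceType) (f : K -> K') (m : {mset K}) :
    {mset K'} :=
  seq_mset [seq f x | x <- enum_mset m].

Record procLang (A : Type) := ProcLang {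
  lobj : Type;
  ltrans : lobj -> A -> action A -> {mset atomic A lobj} -> Prop
}.

Section Runtime.
Variables (A : Type) (PL : set (procLang A)).

(* The tag is an element of the subtype {L | L \in PL}, where \in is boolean;
   hence an object of L has exactly one tagged copy. *)
Definition nobj : Type := {L : PL & lobj (sval L)}.
Definition cfg : Type := {mset atomic A nobj}.
Definition ncfg : Type := (cfg * nobj)%type.

Definition tag_obj (L : PL) (P : lobj (sval L)) : nobj :=
  existT (fun L : PL => lobj (sval L)) L P.

Definition lang_in (L : procLang A) (LPL : PL L) : PL :=
  exist (fun L => L \in PL) L (mem_set LPL).

Definition tag_cfg (L : PL) (W : {mset atomic A (lobj (sval L))}) : cfg :=
  mset_map (atomic_map (@tag_obj L)) W.

Definition plug (N : ncfg) (a : A) : cfg := N.1 `+` [mset Proc a N.2].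

Inductive trans : cfg -> action A -> cfg -> Prop :=
  | trans_obj (L : PL) (P : lobj (sval L)) (a : A) (al : action A)
      (W' : {mset atomic A (lobj (sval L))}) :
      ltrans P a al W' ->
      trans [mset Proc a (tag_obj P)] al (tag_cfg W')
  | trans_fwd (a b : A) (P : nobj) :
      trans ([mset Proc a P] `+` [mset Fwd b a]) Silent [mset Proc b P]
  | trans_frame (W W' W0 : cfg) (al : action A) :
      trans W al W' -> trans (W `+` W0) al (W' `+` W0)
  | trans_comm (W1 W1' W2 W2' : cfg) (a : A) (c : payload A) :
      trans W1 (a !! c) W1' -> trans W2 (a ?? c) W2' ->
      trans (W1 `+` W2) Silent (W1' `+` W2').

Definition steps : cfg -> cfg -> Prop :=
  clos_refl_trans cfg (fun W W' => trans W Silent W').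

Definition nsteps (N N' : ncfg) : Prop :=
  forall a : A, steps (plug N a) (plug N' a).

End Runtime.

Inductive ty : Type :=
  | One
  | Tensor of ty & ty
  | Plus of ty & ty
  | With of ty & ty
  | Lolli of ty & ty.

Section LogicalRelation.
Variables (A : Type) (PL : set (procLang A)).

Definition eclosure (V : set (ncfg PL)) : set (ncfg PL) :=
  [set N | exists N', nsteps N N' /\ V N'].

Fixpoint logV (T : ty) : set (ncfg PL) :=
  match T with
  | One => [set N | forall a, trans (plug N a) (a !! Close) mset0]
  | Tensor T1 T2 => [set N | exists a, forall b,
      exists2 N1, eclosure (logV T1) N1 &
      exists2 N2, eclosure (logV T2) N2 &
      trans (plug N b) (b !! Name a) (plug N1 a `+` plug N2 b)]
  | Lolli T1 T2 => [set N | forall a b N1, eclosure (logV T1) N1 ->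
      exists2 N2, eclosure (logV T2) N2 &
      trans (plug N b `+` plug N1 a) (b ?? Name a) (plug N2 b)]
  | With T1 T2 => [set N |
      (forall a, exists2 N1, eclosure (logV T1) N1 &
         trans (plug N a) (a ?? Pi1) (plug N1 a)) /\
      (forall a, exists2 N2, eclosure (logV T2) N2 &
         trans (plug N a) (a ?? Pi2) (plug N2 a))]
  | Plus T1 T2 => [set N |
      (forall a, exists2 N1, eclosure (logV T1) N1 &
         trans (plug N a) (a !! Pi1) (plug N1 a)) \/
      (forall a, exists2 N2, eclosure (logV T2) N2 &
         trans (plug N a) (a !! Pi2) (plug N2 a))]
  end.

Definition logE (T : ty) : set (ncfg PL) := eclosure (logV T).

End LogicalRelation.

Inductive bf_state : Type := S0 | S1 | S2 | S3.

Inductive bf_trans (A : Type) :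
    bf_state -> A -> action A -> {mset atomic A bf_state} -> Prop :=
  | bf_0_1 a : bf_trans S0 a (a ?? Pi1) [mset Proc a S1]
  | bf_0_2 a : bf_trans S0 a (a ?? Pi2) [mset Proc a S2]
  | bf_1_3 a : bf_trans S1 a (a !! Pi2) [mset Proc a S3]
  | bf_2_3 a : bf_trans S2 a (a !! Pi1) [mset Proc a S3]
  | bf_3 a : bf_trans S3 a (a !! Close) mset0.

Definition bit_flip (A : Type) : procLang A := ProcLang (@bf_trans A).

(* Main.v *)
(* S_0 answers either request by moving to S_1 or S_2, each of which emits one
   bit and moves to S_3, which closes.  All these states are already values, so
   no silent step is needed: each membership in E holds with N' = N. *)
Require Import Defs.

Local Open Scope classical_set_scope.
Local Open Scope mset_scope.

Lemma mset_map0 {K K' : choiceType} (f : K -> K') : mset_map f mset0 = mset0.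
(* The right-hand side becomes [seq_mset] of its own enumeration, so both sides are built from the
   same list. *)
Proof. by rewrite /mset_map enum_mset0 -[RHS]seq_mset_id enum_mset0. Qed.

Lemma mset_map1 {K K' : choiceType} (f : K -> K') (x : K) :
  mset_map f [mset x] = [mset f x].
Proof. by rewrite /mset_map enum_msetn -[RHS]seq_mset_id enum_msetn. Qed.

Lemma eclosure_refl {A : Type} {PL : set (procLang A)} (V : set (ncfg PL)) :
  (V `<=` eclosure V)%classic.
Proof. by move=> N VN; exists N; split=> // a; apply: rt_refl. Qed.

Section BitFlip.
Context {A : Type} {PL : set (procLang A)} (bf_in : PL (bit_flip A)).

Definition bf_ncfg (s : bf_state) : ncfg PL :=
  (mset0, @tag_obj A PL (lang_in bf_in) s).

(** With an empty context, [plug] yields a singleton, so the object rule applies without framing. *)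
Lemma trans_bf_ncfg {s : bf_state} {a : A} {al : action A}
    {W : {mset atomic A bf_state}} :
  bf_trans s a al W ->
  trans (plug (bf_ncfg s) a) al (@tag_cfg A PL (lang_in bf_in) W).
Proof. by move=> sW; rewrite /plug mset0D; apply: trans_obj. Qed.

Lemma trans_bf_ncfg1 {s s' : bf_state} {a : A} {al : action A} :
  bf_trans s a al [mset Proc a s'] ->
  trans (plug (bf_ncfg s) a) al (plug (bf_ncfg s') a).
Proof. by move=> /trans_bf_ncfg; rewrite /tag_cfg mset_map1 /plug !mset0D. Qed.

End BitFlip.

Theorem theorem12 (A : Type)
    (A_countable : countable [set: A]) (A_infinite : infinite_set [set: A])
    (PL : set (procLang A)) (bf_in : PL (bit_flip A)) :
  logE (With (Plus One One) (Plus One One))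
    ((mset0, @tag_obj A PL (lang_in bf_in) S0) : ncfg PL).
Proof.
have E3 : eclosure (logV One) (bf_ncfg bf_in S3).
  apply: eclosure_refl => a.
  (* Closing leaves no object, so the target is the empty configuration, not a [plug]. *)
  by have := trans_bf_ncfg bf_in (bf_3 a); rewrite /tag_cfg mset_map0.
apply: eclosure_refl; split=> a.
- exists (bf_ncfg bf_in S1); last exact: trans_bf_ncfg1 (bf_0_1 a).
  (* The flip of [Pi1] is [Pi2]: [S1] inhabits the right summand. *)
  apply: eclosure_refl; right=> b.
  by exists (bf_ncfg bf_in S3) => //; exact: trans_bf_ncfg1 (bf_1_3 b).
- exists (bf_ncfg bf_in S2); last exact: trans_bf_ncfg1 (bf_0_2 a).
  (* Dually, [S2] emits [Pi1], hence the left summand. *)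
  apply: eclosure_refl; left=> b.
  by exists (bf_ncfg bf_in S3) => //; exact: trans_bf_ncfg1 (bf_2_3 b).
Qed.
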